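(* Let $D=\mathbb{N}_{>1}$ be the set of integers greater than $1$ under multiplication. Then: (1) proper divisibility is irreflexive: $\forall a\in D\ \neg(a\mid_D a)$; (2) the atoms of the multiplicative semigroup $D$ are exactly the ordinary primes: $\forall p\in D\ \bigl(\operatorname{Atom}_D(p)\iff\operatorname{P}(p)\bigr)$; (3) the prime-element predicate relative to proper divisibility is empty: $\forall p\in D\ \neg\operatorname{PrimeEl}_D(p)$. All three assertions are constructively provable in Heyting Arithmetic $\mathsf{HA}$.
   Context: Logic is intuitionistic. For $a,b\in D$: $a\mid_D b\iff\exists c\in D\,(ac=b)$. $\operatorname{Atom}_D(p)\iff p\in D\wedge\neg\exists a,b\in D\,(ab=p)$. $\operatorname{PrimeEl}_D(p)\iff p\in D\wedge\forall a,b\in D\,\bigl(p\mid_D ab\to p\mid_D a\vee p\mid_D b\bigr)$. The ordinary prime predicate is $\operatorname{P}(n)\iff n>1\wedge\forall a,b\le n\,\neg(a>1\wedge b>1\wedge ab=n)$. *)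

(* Defs.v *)
From mathcomp Require Import all_boot.
From Stdlib Require List.

Set Implicit Arguments.
Unset Strict Implicit.
Unset Printing Implicit Defensive.

(* Divisibility in a set D of naturals closed under multiplication: the cofactor
   must itself lie in D. *)

Definition Dvd_in (D : {pred nat}) (a b : nat) : Prop :=
  exists2 c, c \in D & a * c = b.

Definition Atom_in (D : {pred nat}) (p : nat) : Prop :=
  p \in D /\ ~ (exists a b, [/\ a \in D, b \in D & a * b = p]).

Definition PrimeEl_in (D : {pred nat}) (p : nat) : Prop :=
  p \in D /\
  forall a b, a \in D -> b \in D ->
    Dvd_in D p (a * b) -> Dvd_in D p a \/ Dvd_in D p b.

Definition OrdPrime (n : nat) : Prop :=
  1 < n /\
  forall a b, a <= n -> b <= n -> ~ [/\ 1 < a, 1 < b & a * b = n].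

Definition Ngt1 : {pred nat} := [pred n | 1 < n].

(* Heyting Arithmetic: first-order intuitionistic logic with equality over the
   signature 0, S, +, *.  Variables are de Bruijn indices; in AllF A and ExF A,
   index 0 of A is the bound variable. *)

Inductive term : Type :=
  | Var of nat
  | ZeroT
  | SuccT of term
  | AddT of term & term
  | MulT of term & term.

Inductive formula : Type :=
  | BotF
  | EqF of term & term
  | AndF of formula & formula
  | OrF of formula & formula
  | ImpF of formula & formula
  | AllF of formula
  | ExF of formula.

Definition NotF A := ImpF A BotF.
Definition IffF A B := AndF (ImpF A B) (ImpF B A).

Fixpoint tsubst (s : nat -> term) (t : term) : term :=
  match t with
  | Var n => s n
  | ZeroT => ZeroT
  | SuccT t1 => SuccT (tsubst s t1)
  | AddT t1 t2 => AddT (tsubst s t1) (tsubst s t2)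
  | MulT t1 t2 => MulT (tsubst s t1) (tsubst s t2)
  end.

Definition scons (t : term) (s : nat -> term) (n : nat) : term :=
  if n is m.+1 then s m else t.

Definition tshift : term -> term := tsubst (fun n => Var n.+1).

Definition up (s : nat -> term) : nat -> term :=
  scons (Var 0) (fun n => tshift (s n)).

Fixpoint fsubst (s : nat -> term) (A : formula) : formula :=
  match A with
  | BotF => BotF
  | EqF t1 t2 => EqF (tsubst s t1) (tsubst s t2)
  | AndF A1 A2 => AndF (fsubst s A1) (fsubst s A2)
  | OrF A1 A2 => OrF (fsubst s A1) (fsubst s A2)
  | ImpF A1 A2 => ImpF (fsubst s A1) (fsubst s A2)
  | AllF A1 => AllF (fsubst (up s) A1)
  | ExF A1 => ExF (fsubst (up s) A1)
  end.

Definition fshift : formula -> formula := fsubst (fun n => Var n.+1).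

Definition inst (A : formula) (t : term) : formula := fsubst (scons t Var) A.

(* The substitution in the induction step sends x to S x in place: both A and
   its image live under the same quantifier.  Instances may contain further free
   variables, which act as universally quantified parameters. *)
Inductive HA_axiom : formula -> Prop :=
  | ax_succ_neq0 t : HA_axiom (NotF (EqF (SuccT t) ZeroT))
  | ax_succ_inj t u : HA_axiom (ImpF (EqF (SuccT t) (SuccT u)) (EqF t u))
  | ax_add0 t : HA_axiom (EqF (AddT t ZeroT) t)
  | ax_addS t u : HA_axiom (EqF (AddT t (SuccT u)) (SuccT (AddT t u)))
  | ax_mul0 t : HA_axiom (EqF (MulT t ZeroT) ZeroT)
  | ax_mulS t u : HA_axiom (EqF (MulT t (SuccT u)) (AddT (MulT t u) t))
  | ax_ind A :
      HA_axiom
        (ImpF (inst A ZeroT)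
           (ImpF
              (AllF (ImpF A
                 (fsubst (scons (SuccT (Var 0)) (fun n => Var n.+1)) A)))
              (AllF A))).

Inductive HA_derives : seq formula -> formula -> Prop :=
  | d_axiom G A : HA_axiom A -> HA_derives G A
  | d_hyp G A : List.In A G -> HA_derives G A
  | d_botE G A : HA_derives G BotF -> HA_derives G A
  | d_andI G A B :
      HA_derives G A -> HA_derives G B -> HA_derives G (AndF A B)
  | d_andE1 G A B : HA_derives G (AndF A B) -> HA_derives G A
  | d_andE2 G A B : HA_derives G (AndF A B) -> HA_derives G B
  | d_orI1 G A B : HA_derives G A -> HA_derives G (OrF A B)
  | d_orI2 G A B : HA_derives G B -> HA_derives G (OrF A B)
  | d_orE G A B C :
      HA_derives G (OrF A B) ->
      HA_derives (A :: G) C -> HA_derives (B :: G) C -> HA_derives G C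
  | d_impI G A B : HA_derives (A :: G) B -> HA_derives G (ImpF A B)
  | d_impE G A B :
      HA_derives G (ImpF A B) -> HA_derives G A -> HA_derives G B
  | d_allI G A : HA_derives (map fshift G) A -> HA_derives G (AllF A)
  | d_allE G A t : HA_derives G (AllF A) -> HA_derives G (inst A t)
  | d_exI G A t : HA_derives G (inst A t) -> HA_derives G (ExF A)
  | d_exE G A C :
      HA_derives G (ExF A) ->
      HA_derives (A :: map fshift G) (fshift C) -> HA_derives G C
  | d_eqrefl G t : HA_derives G (EqF t t)
  | d_eqE G A t u :
      HA_derives G (EqF t u) ->
      HA_derives G (inst A t) -> HA_derives G (inst A u).

Definition HA_provable (A : formula) : Prop := HA_derives [::] A.

(* Arithmetical formulas for the notions above, with D = {n | n > 1}. *)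

Definition LeF (t u : term) : formula :=
  ExF (EqF (AddT (tshift t) (Var 0)) (tshift u)).

Definition LtF (t u : term) : formula := LeF (SuccT t) u.

Definition InDF (t : term) : formula := LtF (SuccT ZeroT) t.

Definition AllDF (A : formula) : formula := AllF (ImpF (InDF (Var 0)) A).
Definition ExDF (A : formula) : formula := ExF (AndF (InDF (Var 0)) A).

Definition DvdF (t u : term) : formula :=
  ExDF (EqF (MulT (tshift t) (Var 0)) (tshift u)).

(* Under two quantifiers "a, b", a is Var 1 and b is Var 0. *)

Definition AtomF (t : term) : formula :=
  AndF (InDF t)
    (NotF (ExDF (ExDF (EqF (MulT (Var 1) (Var 0)) (tshift (tshift t)))))).

Definition PrimeElF (t : term) : formula :=
  AndF (InDF t)
    (AllDF (AllDF
       (ImpF (DvdF (tshift (tshift t)) (MulT (Var 1) (Var 0)))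
             (OrF (DvdF (tshift (tshift t)) (Var 1))
                  (DvdF (tshift (tshift t)) (Var 0)))))).

Definition OrdPrimeF (t : term) : formula :=
  AndF (LtF (SuccT ZeroT) t)
    (AllF (ImpF (LeF (Var 0) (tshift t))
       (AllF (ImpF (LeF (Var 0) (tshift (tshift t)))
          (NotF (AndF (LtF (SuccT ZeroT) (Var 1))
                (AndF (LtF (SuccT ZeroT) (Var 0))
                      (EqF (MulT (Var 1) (Var 0)) (tshift (tshift t)))))))))).

(* Main.v *)
Require Import Defs.
From mathcomp Require Import all_boot.
From Stdlib Require Import Setoid Morphisms.

(** Everything rests on one computation. If 1 < c, write c = y.+2; then
    a * c = a * y.+1 + a. Two facts follow at once. First, a * c = a forces
    a * y.+1 = 0, which is absurd for a > 1: no element of D divides itself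
    with a cofactor in D. Second, a <= a * c, and symmetrically c <= a * c when
    a > 1, so the bounds in the definition of an ordinary prime hold of every
    factorization in D, and ordinary primes coincide with atoms.
    Finally, every p in D divides p * p with cofactor p, so a prime element
    would satisfy p | p, against irreflexivity.

    The derivations in Heyting Arithmetic follow the same argument. Its
    arithmetic is needed only as equations between terms, stated for an
    arbitrary context G and arbitrary terms ([add_comm], [mulSl]) and completed
    by the cancellation law [add_cancel]. Since G is arbitrary, these schemas
    apply below any number of quantifiers and hypotheses, so that neither
    weakening nor substitution has to be proved admissible. The inequalities
    x <= y are proved by explicit witnesses. The logical part of each
    derivation then manipulates concrete contexts, in which shifted hypotheses
    are found by computation. *)

Set Implicit Arguments.
Unset Strict Implicit.
Unset Printing Implicit Defensive.

(** * The three assertions for natural numbers *)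

Lemma Dvd_irreflexive a : a \in Ngt1 -> ~ Dvd_in Ngt1 a a.
Proof.
rewrite inE => a_gt1 [c]; rewrite inE => c_gt1 /eqP.
have a_gt0 := ltnW a_gt1.
by rewrite -{2}[a]muln1 eqn_pmul2l // gtn_eqF.
Qed.

Lemma Atom_OrdPrime p : p \in Ngt1 -> Atom_in Ngt1 p <-> OrdPrime p.
Proof.
move=> Dp; split=> [[_ atom_p] | [_ prime_p]].
  split=> // a b _ _ [a_gt1 b_gt1 def_p].
  by apply: atom_p; exists a, b.
split=> // -[a [b [Da Db def_p]]].
apply: (prime_p a b); rewrite -?def_p //.
  by rewrite leq_pmulr // ltnW.
by rewrite leq_pmull // ltnW.
Qed.

Lemma no_PrimeEl p : p \in Ngt1 -> ~ PrimeEl_in Ngt1 p.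
Proof.
move=> Dp [_ /(_ p p Dp Dp)] prime_p.
have /prime_p : Dvd_in Ngt1 p (p * p) by exists p.
by case; apply: Dvd_irreflexive.
Qed.

(** * Equational reasoning inside Heyting Arithmetic *)

Notation "G |-- A" := (HA_derives G A) (at level 70, no associativity).

Definition provably_equal G t u := G |-- EqF t u.
Notation "t ~[ G ] u" := (provably_equal G t u)
  (at level 70, no associativity, format "t  ~[ G ]  u").

Lemma tshiftK u t : tsubst (scons u Var) (tshift t) = t.
Proof. by elim: t => //= [t -> | t -> v -> | t -> v ->]. Qed.

Lemma tshift_succ t :
  tsubst (scons (SuccT (Var 0)) (fun n => Var n.+1)) (tshift t) = tshift t.
Proof. by elim: t => //= [t -> | t -> v -> | t -> v ->]. Qed.

(** Leibniz's rule for the equation r(x) = l, where the replaced position is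
    the variable 0 of r; symmetry, transitivity and all congruences are
    instances. *)
Lemma eq_replace G r l t u :
  t ~[G] u -> tsubst (scons t Var) r ~[G] l -> tsubst (scons u Var) r ~[G] l.
Proof.
move=> eq_tu eq_tl.
have := @d_eqE G (EqF r (tshift l)) t u eq_tu.
by rewrite /inst /= !tshiftK; apply.
Qed.

Lemma eq_refl G t : t ~[G] t. Proof. exact: d_eqrefl. Qed.

Lemma eq_sym G t u : t ~[G] u -> u ~[G] t.
Proof.
by move=> eq_tu; apply: (eq_replace (r := Var 0) eq_tu); apply: eq_refl.
Qed.

Lemma eq_trans G t u v : t ~[G] u -> u ~[G] v -> t ~[G] v.
Proof. by move/eq_sym; apply: (eq_replace (r := Var 0)). Qed.

#[local] Instance provably_equal_equivalence G : Equivalence (provably_equal G).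
Proof.
split; [exact: eq_refl | exact: eq_sym | exact: eq_trans].
Qed.

#[local] Instance SuccT_proper G :
  Proper (provably_equal G ==> provably_equal G) SuccT.
Proof.
move=> t u /eq_sym eq_ut.
exact: (eq_replace (r := SuccT (Var 0)) eq_ut (eq_refl _ _)).
Qed.

#[local] Instance AddT_proper G :
  Proper (provably_equal G ==> provably_equal G ==> provably_equal G) AddT.
Proof.
move=> t t' /eq_sym eq_t u u' /eq_sym eq_u.
have := eq_replace (r := AddT (Var 0) (tshift u)) (l := AddT t' u) eq_t.
rewrite /= !tshiftK => /(_ (eq_refl _ _)) /eq_trans; apply.
have := eq_replace (r := AddT (tshift t') (Var 0)) (l := AddT t' u') eq_u.
by rewrite /= !tshiftK; apply; apply: eq_refl.
Qed.

#[local] Instance MulT_proper G :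
  Proper (provably_equal G ==> provably_equal G ==> provably_equal G) MulT.
Proof.
move=> t t' /eq_sym eq_t u u' /eq_sym eq_u.
have := eq_replace (r := MulT (Var 0) (tshift u)) (l := MulT t' u) eq_t.
rewrite /= !tshiftK => /(_ (eq_refl _ _)) /eq_trans; apply.
have := eq_replace (r := MulT (tshift t') (Var 0)) (l := MulT t' u') eq_u.
by rewrite /= !tshiftK; apply; apply: eq_refl.
Qed.

Lemma induction_rule G A t :
  G |-- inst A ZeroT ->
  A :: map fshift G
    |-- fsubst (scons (SuccT (Var 0)) (fun n => Var n.+1)) A ->
  G |-- inst A t.
Proof.
move=> base step; apply: d_allE.
apply: d_impE (d_allI (d_impI step)); apply: d_impE base.
exact: d_axiom (ax_ind A).
Qed.

(** The induction step is required in every context H rather than only in the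
    one where the induction hypothesis is assumed: an opaque H does not exhibit
    the terms l and r, so rewriting with the induction hypothesis acts on the
    goal equation alone. *)
Lemma eq_induction_rule G l r t
    (S0 := scons (SuccT (Var 0)) (fun n => Var n.+1)) :
  tsubst (scons ZeroT Var) l ~[G] tsubst (scons ZeroT Var) r ->
  (forall H, l ~[H] r -> tsubst S0 l ~[H] tsubst S0 r) ->
  tsubst (scons t Var) l ~[G] tsubst (scons t Var) r.
Proof.
move=> base step; apply: (@induction_rule G (EqF l r) t base).
by apply: step; apply: d_hyp; left.
Qed.

(** * Arithmetic *)

Lemma add0r G t : AddT t ZeroT ~[G] t.
Proof. exact/d_axiom/ax_add0. Qed.

Lemma addSr G t u : AddT t (SuccT u) ~[G] SuccT (AddT t u).
Proof. exact/d_axiom/ax_addS. Qed.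

Lemma mul0r G t : MulT t ZeroT ~[G] ZeroT.
Proof. exact/d_axiom/ax_mul0. Qed.

Lemma mulSr G t u : MulT t (SuccT u) ~[G] AddT (MulT t u) t.
Proof. exact/d_axiom/ax_mulS. Qed.

Lemma succ_inj G t u : SuccT t ~[G] SuccT u -> t ~[G] u.
Proof. by apply: d_impE; apply/d_axiom/ax_succ_inj. Qed.

Lemma succ_neq0 G t : SuccT t ~[G] ZeroT -> G |-- BotF.
Proof. by apply: d_impE; apply/d_axiom/ax_succ_neq0. Qed.

Lemma add0l G t : AddT ZeroT t ~[G] t.
Proof.
apply: (@eq_induction_rule G (AddT ZeroT (Var 0)) (Var 0)) => /= [|H IH].
  exact: add0r.
by rewrite addSr IH; reflexivity.
Qed.

Lemma addSl G t u : AddT (SuccT t) u ~[G] SuccT (AddT t u).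
Proof.
have := @eq_induction_rule G (AddT (SuccT (tshift t)) (Var 0))
  (SuccT (AddT (tshift t) (Var 0))) u.
rewrite /= !tshiftK !tshift_succ; apply => [|H IH].
  by rewrite !add0r; reflexivity.
by rewrite !addSr IH; reflexivity.
Qed.

Lemma add_comm G t u : AddT t u ~[G] AddT u t.
Proof.
have := @eq_induction_rule G (AddT (tshift t) (Var 0))
  (AddT (Var 0) (tshift t)) u.
rewrite /= !tshiftK !tshift_succ; apply => [|H IH].
  by rewrite add0r add0l; reflexivity.
by rewrite addSr addSl IH; reflexivity.
Qed.

Lemma add_right_comm G t u v : AddT (AddT t u) v ~[G] AddT (AddT t v) u.
Proof.
have := @eq_induction_rule G (AddT (AddT (tshift t) (tshift u)) (Var 0))
  (AddT (AddT (tshift t) (Var 0)) (tshift u)) v.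
rewrite /= !tshiftK !tshift_succ; apply => [|H IH].
  by rewrite !add0r; reflexivity.
by rewrite !addSr addSl IH; reflexivity.
Qed.

Lemma mulSl G t u : MulT (SuccT t) u ~[G] AddT (MulT t u) u.
Proof.
have := @eq_induction_rule G (MulT (SuccT (tshift t)) (Var 0))
  (AddT (MulT (tshift t) (Var 0)) (Var 0)) u.
rewrite /= !tshiftK !tshift_succ; apply => [|H IH].
  by rewrite !mul0r add0r; reflexivity.
rewrite !mulSr !addSr IH add_right_comm; reflexivity.
Qed.

(** The hypothesis has to be part of the formula proved by induction on t, as
    it varies with t; hence the implication inside the object language. *)
Lemma add_cancel G s t : AddT s t ~[G] t -> s ~[G] ZeroT.
Proof.
pose A := ImpF (EqF (AddT (tshift s) (Var 0)) (Var 0)) (EqF (tshift s) ZeroT).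
have := @induction_rule G A t.
rewrite /inst /= !tshiftK !tshift_succ => ind; apply: d_impE; apply: ind.
  apply: d_impI; apply: eq_trans (eq_sym (add0r _ _)) _.
  by apply: d_hyp; left.
apply: d_impI; apply: d_impE; first by apply: d_hyp; right; left.
apply: succ_inj; apply: eq_trans (eq_sym (addSr _ _ _)) _.
by apply: d_hyp; left.
Qed.

Lemma LeF_witness G t k u : AddT t k ~[G] u -> G |-- LeF t u.
Proof. by move=> def_u; apply: (@d_exI _ _ k); rewrite /inst /= !tshiftK. Qed.

(** The body of [InDF t], instantiated at k, says t = 2 + k, with the 2 on the
    left, where the recursion equations of addition do not reduce it. *)
Lemma two_plus G k t :
  AddT (SuccT (SuccT ZeroT)) k ~[G] t -> SuccT (SuccT k) ~[G] t.
Proof. by rewrite !addSl add0l. Qed.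

(** For c = y.+2, cancelling a in a * c = a leaves a * y.+1 = 0, whose left side
    is a successor since a is. *)
Lemma mul_neq_left G a c x y :
  AddT (SuccT (SuccT ZeroT)) x ~[G] a ->
  AddT (SuccT (SuccT ZeroT)) y ~[G] c -> MulT a c ~[G] a -> G |-- BotF.
Proof.
move=> /two_plus def_a /two_plus def_c.
rewrite -def_c mulSr => /add_cancel.
by rewrite mulSr -{2}def_a addSr; apply: succ_neq0.
Qed.

Lemma factor_le_left G a c y p :
  AddT (SuccT (SuccT ZeroT)) y ~[G] c -> MulT a c ~[G] p -> G |-- LeF a p.
Proof.
move=> /two_plus def_c def_p; apply: (@LeF_witness _ _ (MulT a (SuccT y))).
by rewrite -def_p -def_c [X in _ ~[G] X]mulSr add_comm; reflexivity.
Qed.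

Lemma factor_le_right G a c x p :
  AddT (SuccT (SuccT ZeroT)) x ~[G] a -> MulT a c ~[G] p -> G |-- LeF c p.
Proof.
move=> /two_plus def_a def_p; apply: (@LeF_witness _ _ (MulT (SuccT x) c)).
by rewrite -def_p -def_a [X in _ ~[G] X]mulSl add_comm; reflexivity.
Qed.

(** * The derivations in Heyting Arithmetic *)

(** Contexts are concrete up to a tail: [hyp n] uses the n-th hypothesis, whose
    shifts and substitutions are resolved by conversion. *)
Ltac hyp_member n :=
  match n with
  | 0 => left; reflexivity
  | S ?m => right; hyp_member m
  end.

Ltac hyp n := apply: d_hyp; hyp_member n.

Lemma derives_Dvd_irreflexive G :
  G |-- AllDF (NotF (DvdF (Var 0) (Var 0))).
Proof.
apply/d_allI/d_impI/d_impI.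
eapply d_exE; [hyp 0 | cbn].
(* Here c is variable 0 and a is variable 1; both are written as 2 + _. *)
eapply d_exE; [hyp 2 | cbn].
eapply d_exE; [by apply: d_andE1; hyp 1 | cbn].
apply: (@mul_neq_left _ (Var 3) (Var 2) (Var 1) (Var 0)); [hyp 1 | hyp 0 |].
by apply: d_andE2; hyp 2.
Qed.

Lemma derives_Atom_OrdPrime G :
  G |-- AllDF (IffF (AtomF (Var 0)) (OrdPrimeF (Var 0))).
Proof.
apply/d_allI/d_impI; apply: d_andI; apply: d_impI.
  apply: d_andI; first by hyp 1.
  apply/d_allI/d_impI/d_allI/d_impI/d_impI; cbn.
  (* An atom has no factorization a * b; here a and b are variables 1 and 0. *)
  apply: d_impE; first by apply: d_andE2; hyp 3.
  apply: (@d_exI _ _ (Var 1)); cbn; apply: d_andI.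
    by apply: d_andE1; hyp 0.
  apply: (@d_exI _ _ (Var 0)); cbn; apply: d_andI.
    by apply: d_andE1; apply: d_andE2; hyp 0.
  by apply: d_andE2; apply: d_andE2; hyp 0.
apply: d_andI; first by hyp 1.
apply: d_impI.
eapply d_exE; [hyp 0 | cbn].
eapply d_exE; [by apply: d_andE2; hyp 0 | cbn].
eapply d_exE; [by apply: d_andE1; hyp 1 | cbn].
eapply d_exE; [by apply: d_andE1; hyp 1 | cbn].
(* The variables are now p = 4, a = 3 and b = 2, with a = 2 + x for x = 1 and
   b = 2 + y for y = 0. *)
set H := (X in X |-- _).
have def_p : MulT (Var 3) (Var 2) ~[H] Var 4 by apply: d_andE2; hyp 2.
have def_a : AddT (SuccT (SuccT ZeroT)) (Var 1) ~[H] Var 3 by hyp 1.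
have def_b : AddT (SuccT (SuccT ZeroT)) (Var 0) ~[H] Var 2 by hyp 0.
have prime_p : H |-- OrdPrimeF (Var 4) by hyp 5.
have /d_impE/(_ (factor_le_left def_b def_p)) bound_b :=
  d_allE (Var 3) (d_andE2 prime_p).
have /d_impE/(_ (factor_le_right def_a def_p)) no_factorization :=
  d_allE (Var 2) bound_b.
apply: d_impE no_factorization _.
apply: d_andI (LeF_witness def_a) _.
exact: d_andI (LeF_witness def_b) def_p.
Qed.

Lemma derives_no_PrimeEl G :
  G |-- AllDF (NotF (PrimeElF (Var 0))).
Proof.
apply/d_allI/d_impI/d_impI; cbn -[PrimeElF]; set H := (X in X |-- _).
have Dp : H |-- InDF (Var 0) by hyp 1.
have prime_p : H |-- PrimeElF (Var 0) by hyp 0.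
have dvd_pp : H |-- DvdF (Var 0) (MulT (Var 0) (Var 0)).
  by apply: (@d_exI _ _ (Var 0)); apply: d_andI Dp (eq_refl _ _).
have bound_a := d_impE (d_allE (Var 0) (d_andE2 prime_p)) Dp.
have prime_pp := d_impE (d_allE (Var 0) bound_a) Dp.
have irr K (DpK : K |-- InDF (Var 0)) :=
  d_impE (d_allE (Var 0) (derives_Dvd_irreflexive K)) DpK.
(* Both disjuncts say that p divides p. *)
by apply: d_orE (d_impE prime_pp dvd_pp) _ _;
  (apply: d_impE (irr _ _) _; [hyp 2 | hyp 0]).
Qed.

Theorem proposition2p2p6 :
  [/\ (forall a : nat, a \in Ngt1 -> ~ Dvd_in Ngt1 a a),
      (forall p : nat, p \in Ngt1 -> (Atom_in Ngt1 p <-> OrdPrime p)) &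
      (forall p : nat, p \in Ngt1 -> ~ PrimeEl_in Ngt1 p)]
  /\
  [/\ HA_provable (AllDF (NotF (DvdF (Var 0) (Var 0)))),
      HA_provable (AllDF (IffF (AtomF (Var 0)) (OrdPrimeF (Var 0)))) &
      HA_provable (AllDF (NotF (PrimeElF (Var 0))))].
Proof.
split; split.
- exact: Dvd_irreflexive.
- exact: Atom_OrdPrime.
- exact: no_PrimeEl.
- exact: derives_Dvd_irreflexive.
- exact: derives_Atom_OrdPrime.
- exact: derives_no_PrimeEl.
Qed.
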